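(* For any graph $G$ (of order $n$), $\gamma_{rdR}(G)\le 2\gamma_{rR}(G)$, with equality if and only if $G=\overline{K_n}$, the edgeless graph on $n$ vertices.
   Context: All graphs are finite and simple. A restrained double Roman dominating function (RDRD function) of a graph $G$ is a function $f:V(G)\to\{0,1,2,3\}$ such that, with $V_i=\{v\in V(G): f(v)=i\}$: (a) every vertex $v\in V_0$ has at least two neighbors in $V_2$ or at least one neighbor in $V_3$; (b) every vertex $v\in V_1$ has at least one neighbor in $V_2\cup V_3$; (c) the induced subgraph $G[V_0]$ has no isolated vertex. The weight of $f$ is $\sum_{v\in V(G)} f(v)$, and $\gamma_{rdR}(G)$ is the minimum weight of an RDRD function of $G$. A restrained Roman dominating function of $G$ is a function $g:V(G)\to\{0,1,2\}$ such that every vertex $v$ with $g(v)=0$ has a neighbor $w$ with $g(w)=2$, and the subgraph induced by $\{v: g(v)=0\}$ has no isolated vertex. $\gamma_{rR}(G)$ is the minimum weight $\sum_{v} g(v)$ of such a function. *)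

(* Defs.v *)
From mathcomp Require Import all_boot.

Set Implicit Arguments.
Unset Strict Implicit.
Unset Printing Implicit Defensive.

(* A finite simple graph is a symmetric irreflexive relation
   e : rel T on its finite vertex type T. *)

Section Domination.

Variables (T : finType) (e : rel T).

Definition edgeless : Prop := forall x y : T, ~~ e x y.

(* The subgraph induced by A has no isolated vertex. *)
Definition no_isolated (A : {set T}) : bool :=
  [forall v in A, exists w in A, e v w].

Section Labeling.

Variables (k : nat) (f : {ffun T -> 'I_k}).

Definition level (i : nat) : {set T} := [set v | f v == i :> nat].

Definition nbrs_level (v : T) (i : nat) : {set T} := [set w in level i | e v w].

Definition weight : nat := \sum_v f v.

End Labeling.

Definition RDRD (f : {ffun T -> 'I_4}) : bool :=
  [&& [forall v in level f 0,
         (2 <= #|nbrs_level f v 2|) || (1 <= #|nbrs_level f v 3|)],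
      [forall v in level f 1, exists w in level f 2 :|: level f 3, e v w]
    & no_isolated (level f 0)].

Definition RRD (g : {ffun T -> 'I_3}) : bool :=
  [forall v in level g 0, exists w in level g 2, e v w]
  && no_isolated (level g 0).

(* [arg min_] needs a feasible starting point: the constant labelling by the
   largest label always is one (RDRD_max and RRD_max), so gamma_rdR and
   gamma_rR are the genuine minima (gamma_rdRP and gamma_rRP). *)
Definition gamma_rdR : nat :=
  weight [arg min_(f < [ffun => ord_max] | RDRD f) weight f].

Definition gamma_rR : nat :=
  weight [arg min_(g < [ffun => ord_max] | RRD g) weight g].

Lemma level_max k i : i != k ->
  level ([ffun => ord_max] : {ffun T -> 'I_k.+1}) i = set0.
Proof.
by move=> ik; apply/setP=> v; rewrite !inE ffunE /= eq_sym (negbTE ik).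
Qed.

Lemma RDRD_max : RDRD [ffun => ord_max].
Proof.
by apply/and3P; split; apply/forall_inP=> v; rewrite level_max ?inE.
Qed.

Lemma RRD_max : RRD [ffun => ord_max].
Proof.
by apply/andP; split; apply/forall_inP=> v; rewrite level_max ?inE.
Qed.

Lemma gamma_rdRP :
  (exists2 f, RDRD f & weight f = gamma_rdR) /\
  (forall f, RDRD f -> gamma_rdR <= weight f).
Proof.
rewrite /gamma_rdR; case: arg_minnP; first exact: RDRD_max.
by move=> f Hf Hmin; split=> //; exists f.
Qed.

Lemma gamma_rRP :
  (exists2 g, RRD g & weight g = gamma_rR) /\
  (forall g, RRD g -> gamma_rR <= weight g).
Proof.
rewrite /gamma_rR; case: arg_minnP; first exact: RRD_max.
by move=> g Hg Hmin; split=> //; exists g.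
Qed.

End Domination.

(* Main.v *)
(* Relabelling 1 as 2 and 2 as 3 turns a restrained Roman dominating function g
   into an RDRD function of weight 2 w(g) - |V_2(g)|. So equality forces a
   minimum g to have empty V_2, hence empty V_0 and weight at least n; but an
   edge xy would yield an RDRD function of weight 2n - 1, with x labelled 1 and
   all other vertices 2. *)
Require Import Defs.
From mathcomp Require Import all_boot.

Set Implicit Arguments.
Unset Strict Implicit.
Unset Printing Implicit Defensive.

Section Bounds.

Variables (T : finType) (e : rel T).

Definition double_labels (g : {ffun T -> 'I_3}) : {ffun T -> 'I_4} :=
  [ffun v => inord (g v + (0 < g v))].

Lemma double_labelsE g v : double_labels g v = g v + (0 < g v) :> nat.
Proof. by rewrite ffunE inordK //; case: (g v) => [[|[|[|]]]]. Qed.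

Lemma double_labels_eq0 g v : (double_labels g v == 0 :> nat) = (g v == 0 :> nat).
Proof. by rewrite double_labelsE; case: (nat_of_ord (g v)). Qed.

Lemma level0_double_labels g : level (double_labels g) 0 = level g 0.
Proof. by apply/setP => v; rewrite !inE double_labels_eq0. Qed.

(** The vertices labelled 0 stay the same, each neighbour labelled 2 becomes a single neighbour
    labelled 3, and the label 1 no longer occurs. *)
Lemma RDRD_double_labels g : RRD e g -> RDRD e (double_labels g).
Proof.
case/andP => /forall_inP dom_g iso_g.
apply/and3P; split; last by rewrite level0_double_labels.
- apply/forall_inP => v; rewrite level0_double_labels.
  case/dom_g/exists_inP => w; rewrite inE => /eqP gw evw.
  apply/orP; right; apply/card_gt0P; exists w.
  by rewrite !inE double_labelsE gw.
- apply/forall_inP => v; rewrite inE double_labelsE.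
  by case: (nat_of_ord (g v)) => [|[|]].
Qed.

(** Holds vertex by vertex: 0 + 0, 2 + 0 and 3 + 1 are the doubles of 0, 1 and 2. The additive form
    avoids truncated subtraction. *)
Lemma weight_double_labels g :
  weight (double_labels g) + #|level g 2| = 2 * weight g.
Proof.
rewrite /weight -sum1_card [X in _ + X]big_mkcond -big_split big_distrr /=.
apply: eq_bigr => v _; rewrite double_labelsE inE.
by case: (g v) => [[|[|[|]]]].
Qed.

Lemma gamma_rdR_le_double g :
  RRD e g -> gamma_rdR e + #|level g 2| <= 2 * weight g.
Proof.
move=> g_rrd; rewrite -weight_double_labels leq_add2r.
by apply: (gamma_rdRP e).2; apply: RDRD_double_labels.
Qed.

(** A vertex labelled 0 would need a neighbour labelled 2, so every label is at least 1. *)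
Lemma card_leq_weight_RRD g : RRD e g -> level g 2 = set0 -> #|T| <= weight g.
Proof.
case/andP => /forall_inP dom_g _ g2; rewrite -sum1_card /weight.
apply: leq_sum => v _; rewrite lt0n; apply/negP => gv.
have /exists_inP[w] : [exists w in level g 2, e v w] by apply: dom_g; rewrite inE.
by rewrite g2 inE.
Qed.

Lemma gamma_rR_leq_card : gamma_rR e <= #|T|.
Proof.
have <- : weight [ffun _ : T => inord 1 : 'I_3] = #|T|.
  by rewrite -sum1_card; apply: eq_bigr => v _; rewrite ffunE inordK //; case: eqP.
apply: (gamma_rRP e).2; apply/andP.
by split; apply/forall_inP => v; rewrite inE ffunE inordK.
Qed.

Lemma gamma_rdR_edge x y : x != y -> e x y -> gamma_rdR e < 2 * #|T|.
Proof.
move=> xy exy; pose f := [ffun v => inord (2 - (v == x)) : 'I_4].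
have fE v : f v = 2 - (v == x) :> nat by rewrite ffunE inordK //; case: eqP.
have level0_f v : v \in level f 0 = false by rewrite inE fE; case: (v == x).
have f_rdrd : RDRD e f.
  apply/and3P; split; apply/forall_inP => v; rewrite ?level0_f //.
  (* Only [x] has label 1; [y] keeps label 2 because [x != y]. *)
  rewrite inE fE; case: (v =P x) => // -> _; apply/exists_inP; exists y => //.
  by rewrite !inE fE (eq_sym y) (negbTE xy).
apply: leq_ltn_trans ((gamma_rdRP e).2 f f_rdrd) _.
rewrite /weight -sum1_card big_distrr /= (bigD1 x) //= [ltnRHS](bigD1 x) //=.
(* The strict inequality comes from [x] alone, where 1 < 2. *)
rewrite fE eqxx -addSn leq_add // leq_sum // => v vx.
by rewrite fE (negbTE vx).
Qed.

(** Label 1 requires a dominating neighbour and label 0 a neighbour also labelled 0; without edges,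
    every label is at least 2. *)
Lemma edgeless_gamma_rdR_ge : edgeless e -> 2 * #|T| <= gamma_rdR e.
Proof.
move=> e0; have [[f /and3P[_ /forall_inP dom1 /forall_inP iso0] <-] _] := gamma_rdRP e.
rewrite /weight -sum1_card big_distrr; apply: leq_sum => v _ /=.
have no_nbr (A : {set T}) : [exists w in A, e v w] = false.
  by apply/exists_inP => -[w _]; apply/negP/e0.
have := dom1 v; have := iso0 v; rewrite !no_nbr !inE.
by case: (nat_of_ord (f v)) => [|[|]] // => [/(_ isT)|_ /(_ isT)].
Qed.

End Bounds.

Theorem proposition12 (T : finType) (e : rel T)
  (e_sym : symmetric e) (e_irr : irreflexive e) :
  gamma_rdR e <= 2 * gamma_rR e /\
  (gamma_rdR e = 2 * gamma_rR e <-> edgeless e).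
Proof.
have [[g g_rrd g_min] _] := gamma_rRP e.
have le_g := gamma_rdR_le_double g_rrd; rewrite g_min in le_g.
have le_2 : gamma_rdR e <= 2 * gamma_rR e := leq_trans (leq_addr _ _) le_g.
split=> //; split=> [eq_2 x y | e0]; last first.
  apply/eqP; rewrite eqn_leq le_2 /=.
  apply: leq_trans (edgeless_gamma_rdR_ge e0).
  by rewrite leq_mul2l gamma_rR_leq_card.
apply/negP => exy; have xy : x != y by apply: contraTneq exy => ->; rewrite e_irr.
have g2 : level g 2 = set0.
  (* Under equality, [le_g] leaves no room for the term [#|level g 2|]. *)
  by apply: cards0_eq; apply/eqP; rewrite -leqn0 -(leq_add2l (gamma_rdR e)) addn0 {2}eq_2.
(* The edge now forces [weight g < #|T|], while an empty [level g 2] forces the opposite. *)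
have := gamma_rdR_edge xy exy; rewrite eq_2 ltn_mul2l /= ltnNge -g_min.
by rewrite (card_leq_weight_RRD g_rrd g2).
Qed.
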